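(* Let $h\in\Gamma_0(\mathbb{R}^N)$ and let $V=P\pm Q$ be symmetric positive definite (one fixed choice of sign), where $P\in\mathbb{R}^{N\times N}$ is symmetric positive definite and $Q=\sum_{i=1}^r u_iu_i^\top\in\mathbb{R}^{N\times N}$ with $u_1,\dots,u_r\in\mathbb{R}^N$ and $r=\operatorname{rank}(Q)\le N$. Let $U=(u_1,\dots,u_r)\in\mathbb{R}^{N\times r}$. Then, for every $x\in\mathbb{R}^N$, $$\mathrm{prox}^V_h(x)=P^{-1/2}\,\mathrm{prox}_{h\circ P^{-1/2}}\big(P^{1/2}(x\mp P^{-1}U\alpha^\star)\big)=\mathrm{prox}^P_h(x\mp P^{-1}U\alpha^\star),$$ where $\alpha^\star\in\mathbb{R}^r$ is the unique zero of the mapping $\mathcal{L}:\mathbb{R}^r\to\mathbb{R}^r$, $$\mathcal{L}(\alpha)=U^\top\Big(x-P^{-1/2}\,\mathrm{prox}_{h\circ P^{-1/2}}\big(P^{1/2}(x\mp P^{-1}U\alpha)\big)\Big)+\alpha=U^\top\big(x-\mathrm{prox}^P_h(x\mp P^{-1}U\alpha)\big)+\alpha.$$ The mapping $\mathcal{L}$ is Lipschitz continuous with Lipschitz constant $1+\|P^{-1/2}U\|^2$, and strongly monotone with modulus $c$, where $c=1$ if $V=P+Q$ and $c=1-\|P^{-1/2}U\|^2$ if $V=P-Q$. (In each formula the upper sign corresponds to $V=P+Q$ and the lower sign to $V=P-Q$.)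
   Context: $\mathbb{R}^N$ carries the Euclidean inner product $\langle\cdot,\cdot\rangle$ and norm $\|\cdot\|$; for a matrix $A$, $\|A\|$ denotes the spectral (operator) norm. $\Gamma_0(\mathbb{R}^N)$ is the set of proper lower semicontinuous convex functions $\mathbb{R}^N\to\mathbb{R}\cup\{+\infty\}$. For $V$ symmetric positive definite, $\|x\|_V^2=\langle x,Vx\rangle$ and $\mathrm{prox}^V_h(x)=\operatorname{argmin}_{z\in\mathbb{R}^N}\{h(z)+\tfrac12\|x-z\|_V^2\}$ (a unique point); $\mathrm{prox}_h=\mathrm{prox}_h^{\mathrm{Id}}$. $A^{1/2}$ is the principal square root of a positive semidefinite matrix $A$. A mapping $\mathcal{L}$ is strongly monotone with modulus $c>0$ if $\langle\mathcal{L}(\alpha)-\mathcal{L}(\beta),\alpha-\beta\rangle\ge c\|\alpha-\beta\|^2$ for all $\alpha,\beta$. *)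

(* Defs.v *)
From HB Require Import structures.
From mathcomp Require Import all_boot all_order all_algebra.
From mathcomp Require Import all_classical all_reals all_analysis.

Set Implicit Arguments.
Unset Strict Implicit.
Unset Printing Implicit Defensive.

Import Order.TTheory GRing.Theory Num.Theory.
Import numFieldNormedType.Exports.

Local Open Scope classical_set_scope.
Local Open Scope ring_scope.

Section Euclidean.
Variable R : realType.

Definition dotv n (x y : 'cV[R]_n) : R := (x^T *m y) 0 0.

(* The library norm on matrices is the sup norm, hence this definition. *)
Definition enorm n (x : 'cV[R]_n) : R := Num.sqrt (dotv x x).

Definition opnorm m n (A : 'M[R]_(m, n)) : R :=
  sup [set enorm (A *m x) | x in [set x : 'cV[R]_n | enorm x <= 1]].

Definition posdefmx n (A : 'M[R]_n) : Prop :=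
  A^T = A /\ forall x : 'cV[R]_n, x != 0 -> 0 < dotv x (A *m x).

Definition possemidefmx n (A : 'M[R]_n) : Prop :=
  A^T = A /\ forall x : 'cV[R]_n, 0 <= dotv x (A *m x).

(* Default value 0 when A is not positive semidefinite. *)
Definition sqrtmx n (A : 'M[R]_n) : 'M[R]_n :=
  xget 0 [set B : 'M[R]_n | possemidefmx B /\ B *m B = A].

Definition lipschitz_with m n (k : R) (f : 'cV[R]_m -> 'cV[R]_n) : Prop :=
  forall a b, enorm (f a - f b) <= k * enorm (a - b).

Definition strongly_monotone n (c : R) (f : 'cV[R]_n -> 'cV[R]_n) : Prop :=
  0 < c /\ forall a b, c * enorm (a - b) ^+ 2 <= dotv (f a - f b) (a - b).

End Euclidean.

Section Prox.
Variables (R : realType) (n : nat).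
Implicit Types (h : 'cV[R]_n -> \bar R) (V : 'M[R]_n).
Local Open Scope ereal_scope.

Definition proper_fun h : Prop :=
  (forall x, -oo < h x) /\ exists x, h x < +oo.

Definition convex_efun h : Prop :=
  forall (x y : 'cV[R]_n) (t : R), (0 < t < 1)%R ->
    h (t *: x + (1 - t) *: y)%R <= t%:E * h x + (1 - t)%:E * h y.

(* The library topology on column vectors is the sup-norm one, which is the
   Euclidean one. *)
Definition Gamma0 h : Prop :=
  [/\ proper_fun h, lower_semicontinuous h & convex_efun h].

Definition sqnormV V (x : 'cV[R]_n) : R := dotv x (V *m x).

Definition argmin (f : 'cV[R]_n -> \bar R) : set 'cV[R]_n :=
  [set z | forall w, f z <= f w].

(* For h in Gamma0 and V symmetric positive definite the argmin is a
   singleton, so the default value 0 of xget is not used. *)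
Definition proxV V h (x : 'cV[R]_n) : 'cV[R]_n :=
  xget 0%R (argmin (fun z => h z + (2^-1 * sqnormV V (x - z))%:E)).

Definition prox h : 'cV[R]_n -> 'cV[R]_n := proxV 1%:M h.

End Prox.

(* Upper sign iff [plus] holds: pm is the sign in V = P ± Q, mp the opposite one. *)
Definition pm (T : zmodType) (plus : bool) (a b : T) : T :=
  if plus then a + b else a - b.
Definition mp (T : zmodType) (plus : bool) (a b : T) : T :=
  if plus then a - b else a + b.

(* Main.v *)
Require Import Defs.
From HB Require Import structures.
From mathcomp Require Import all_boot all_order all_algebra.
From mathcomp Require Import all_classical all_reals all_analysis.
From mathcomp Require Import ring lra.

Set Implicit Arguments.
Unset Strict Implicit.
Unset Printing Implicit Defensive.

Import Order.TTheory GRing.Theory Num.Theory.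
Import numFieldNormedType.Exports.
Local Open Scope ring_scope.

(* The point p = prox^V_h(x) is characterised by the optimality condition
   V (x - p) \in dh(p).  With a = - U^T (x - p) one has
   V (x - p) = P (x -+ P^-1 U a - p), so the same condition says
   p = prox^P_h(x -+ P^-1 U a), and L a = 0 by the choice of a: no fixed point
   argument is needed for the existence of the zero.  The Lipschitz bound and
   the strong monotonicity of L follow from the firm nonexpansiveness of
   prox^P_h in the P-norm, and strong monotonicity gives uniqueness of the
   zero.  In the case V = P - Q the modulus is positive because
   1 - W W^T, W = P^{-1/2} U, is positive definite, hence coercive. *)

(** * Euclidean inner product, semidefinite forms and operator bounds *)

Section LinearAlgebra.
Variable R : realType.

Lemma dotvE n (x y : 'cV[R]_n) : dotv x y = \sum_i x i 0 * y i 0.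
Proof. by rewrite /dotv mxE; apply: eq_bigr => i _; rewrite mxE. Qed.

Lemma dotvC n (x y : 'cV[R]_n) : dotv x y = dotv y x.
Proof. by rewrite !dotvE; apply: eq_bigr => i _; rewrite mulrC. Qed.

Lemma dotvDr n (x y z : 'cV[R]_n) : dotv x (y + z) = dotv x y + dotv x z.
Proof. by rewrite /dotv mulmxDr mxE. Qed.

Lemma dotvZr n a (x y : 'cV[R]_n) : dotv x (a *: y) = a * dotv x y.
Proof. by rewrite /dotv -scalemxAr mxE. Qed.

Lemma dotvNr n (x y : 'cV[R]_n) : dotv x (- y) = - dotv x y.
Proof. by rewrite /dotv mulmxN mxE. Qed.

Lemma dotvDl n (x y z : 'cV[R]_n) : dotv (y + z) x = dotv y x + dotv z x.
Proof. by rewrite dotvC dotvDr !(dotvC x). Qed.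

Lemma dotvZl n a (x y : 'cV[R]_n) : dotv (a *: y) x = a * dotv y x.
Proof. by rewrite dotvC dotvZr dotvC. Qed.

Lemma dotvNl n (x y : 'cV[R]_n) : dotv (- y) x = - dotv y x.
Proof. by rewrite dotvC dotvNr dotvC. Qed.

Definition dotvlin := (mulmxDr, mulmxN, =^~ scalemxAr, dotvDr, dotvDl, dotvNr,
  dotvNl, dotvZr, dotvZl).

Lemma dotv_mulmx m n (A : 'M[R]_(m, n)) x y :
  dotv x (A *m y) = dotv (A^T *m x) y.
Proof. by rewrite /dotv trmx_mul trmxK mulmxA. Qed.

Lemma dotv_sym n (A : 'M[R]_n) x y : A^T = A ->
  dotv x (A *m y) = dotv y (A *m x).
Proof. by move=> A_sym; rewrite dotv_mulmx A_sym dotvC. Qed.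

Lemma dotv_ge0 n (x : 'cV[R]_n) : 0 <= dotv x x.
Proof. by rewrite dotvE sumr_ge0 // => i _; rewrite -expr2 sqr_ge0. Qed.

Lemma dotv_eq0 n (x : 'cV[R]_n) : (dotv x x == 0) = (x == 0).
Proof.
apply/eqP/eqP => [|->]; last by rewrite dotvE big1 // => i _; rewrite mxE mul0r.
rewrite dotvE => /eqP; rewrite psumr_eq0; last first.
  by move=> i _; rewrite -expr2 sqr_ge0.
move=> /allP x0; apply/colP => i; rewrite mxE; apply/eqP.
by have := x0 i (mem_index_enum i); rewrite /= mulf_eq0 orbb.
Qed.

Lemma dotv_coord n (x : 'cV[R]_n) i : (x i 0) ^+ 2 <= dotv x x.
Proof.
rewrite dotvE (bigD1 i) //= -expr2 lerDl sumr_ge0 // => j _.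
by rewrite -expr2 sqr_ge0.
Qed.

Lemma enorm_ge0 n (x : 'cV[R]_n) : 0 <= enorm x.
Proof. exact: sqrtr_ge0. Qed.

Lemma enorm_sqr n (x : 'cV[R]_n) : enorm x ^+ 2 = dotv x x.
Proof. by rewrite sqr_sqrtr // dotv_ge0. Qed.

Lemma enorm_eq0 n (x : 'cV[R]_n) : (enorm x == 0) = (x == 0).
Proof. by rewrite -dotv_eq0 -enorm_sqr sqrf_eq0. Qed.

Lemma enorm0 n : enorm (0 : 'cV[R]_n) = 0.
Proof. by apply/eqP; rewrite enorm_eq0. Qed.

Lemma enormZ n a (x : 'cV[R]_n) : enorm (a *: x) = `|a| * enorm x.
Proof.
by rewrite /enorm dotvZl dotvZr mulrA -expr2 sqrtrM ?sqr_ge0 // sqrtr_sqr.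
Qed.

Lemma enormN n (x : 'cV[R]_n) : enorm (- x) = enorm x.
Proof. by rewrite -scaleN1r enormZ normrN1 mul1r. Qed.

Lemma enorm_coord n (x : 'cV[R]_n) i : `|x i 0| <= enorm x.
Proof. by rewrite -sqrtr_sqr ler_wsqrtr // dotv_coord. Qed.

Lemma posdef_possemidef n (A : 'M[R]_n) : posdefmx A -> possemidefmx A.
Proof.
case=> A_sym A_pos; split=> // x; have [->|x0] := eqVneq x 0.
  by rewrite mulmx0 dotvE big1 // => i _; rewrite mxE mul0r.
exact/ltW/A_pos.
Qed.

(** With [a], [b], [c] the values of the form at [(x, x)], [(x, y)], [(y, y)]: if [c > 0] the form
    at [c x - b y] equals [c (a c - b^2)], and the case [a > 0] is symmetric. If [a = c = 0], the
    value [- 2 b^2] at [x - b y] forces [b = 0]. *)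
Lemma psd_CS n (A : 'M[R]_n) x y : possemidefmx A ->
  dotv x (A *m y) ^+ 2 <= dotv x (A *m x) * dotv y (A *m y).
Proof.
case=> A_sym A_pos.
have yx := dotv_sym y x A_sym.
have := A_pos (dotv y (A *m y) *: x - dotv x (A *m y) *: y).
have := A_pos (dotv x (A *m x) *: y - dotv x (A *m y) *: x).
have := A_pos (x - dotv x (A *m y) *: y).
have := A_pos x; have := A_pos y.
rewrite !dotvlin yx.
set a := dotv x (A *m x); set b := dotv x (A *m y); set c := dotv y (A *m y).
rewrite le_eqVlt => /orP[/eqP c0|c_gt0 _ _ _ H]; last first.
  rewrite -subr_ge0 -(pmulr_rge0 _ c_gt0); nra.
rewrite le_eqVlt => /orP[/eqP a0 H _ _|a_gt0 _ H _]; last first.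
  rewrite -subr_ge0 -(pmulr_rge0 _ a_gt0); nra.
by rewrite -c0 -a0 in H *; nra.
Qed.

Lemma possemidef1 n : possemidefmx (1%:M : 'M[R]_n).
Proof. by split=> [|x]; rewrite ?trmx1 // mul1mx dotv_ge0. Qed.

Lemma dotv_CS n (x y : 'cV[R]_n) : dotv x y <= enorm x * enorm y.
Proof.
have [xy|xy] := ltP (dotv x y) 0.
  by rewrite (le_trans (ltW xy)) // mulr_ge0 ?enorm_ge0.
rewrite -(@ler_pXn2r _ 2) ?nnegrE ?mulr_ge0 ?enorm_ge0 // exprMn !enorm_sqr.
by have := psd_CS x y (possemidef1 n); rewrite !mul1mx.
Qed.

Lemma enormD n (x y : 'cV[R]_n) : enorm (x + y) <= enorm x + enorm y.
Proof.
rewrite -(@ler_pXn2r _ 2) ?nnegrE ?addr_ge0 ?enorm_ge0 // sqrrD !enorm_sqr.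
have := dotv_CS x y; rewrite !dotvlin (dotvC y x); lra.
Qed.

(** Avoids the supremum in [opnorm], which says nothing until its set is known to be bounded. *)
Definition opbound m n (A : 'M[R]_(m, n)) (k : R) : Prop :=
  forall x, enorm (A *m x) <= k * enorm x.

(** Cauchy-Schwarz on each row, then a sum of squares is at most the square of the sum. The added 1
    makes the bound positive even for [A = 0]. *)
Lemma opbound_ex m n (A : 'M[R]_(m, n)) : exists2 k, 0 < k & opbound A k.
Proof.
exists (1 + \sum_i enorm (row i A)^T).
  by rewrite ltr_pwDl // sumr_ge0 // => i _; rewrite enorm_ge0.
move=> x; set k := \sum_i _.
have k_ge0 : 0 <= k by rewrite sumr_ge0 // => i _; rewrite enorm_ge0.
have sumsq (I : Type) (s : seq I) (f : I -> R) : (forall i, 0 <= f i) ->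
    \sum_(i <- s) f i ^+ 2 <= (\sum_(i <- s) f i) ^+ 2.
  move=> f_ge0; elim: s => [|i s IH]; first by rewrite !big_nil expr0n.
  rewrite !big_cons sqrrD.
  have : 0 <= f i * \sum_(j <- s) f j by rewrite mulr_ge0 ?sumr_ge0.
  by move: IH; lra.
have Ax : enorm (A *m x) <= k * enorm x.
  rewrite -(@ler_pXn2r _ 2) ?nnegrE ?mulr_ge0 ?enorm_ge0 // exprMn !enorm_sqr.
  apply: le_trans (ler_wpM2r (dotv_ge0 x) (sumsq _ _ _ _)); last first.
    by move=> i; rewrite enorm_ge0.
  rewrite dotvE mulr_suml ler_sum // => i _; rewrite enorm_sqr.
  have -> : (A *m x) i 0 = dotv (row i A)^T x.
    by rewrite /dotv trmxK -row_mul [RHS]mxE.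
  rewrite -expr2.
  by have := psd_CS (row i A)^T x (possemidef1 n); rewrite !mul1mx.
by rewrite mulrDl mul1r ler_wpDl // enorm_ge0.
Qed.

(** [|A^T y|^2 = <y, A A^T y> <= |y| k |A^T y|]; then divide by [|A^T y|]. *)
Lemma opbound_tr m n (A : 'M[R]_(m, n)) k : 0 <= k ->
  opbound A k -> opbound A^T k.
Proof.
move=> k_ge0 Ak y.
have [->|y0] := eqVneq (A^T *m y) 0.
  by rewrite enorm0 mulr_ge0 ?enorm_ge0.
have e0 : 0 < enorm (A^T *m y) by rewrite lt_def enorm_eq0 y0 enorm_ge0.
rewrite -(ler_pM2r e0) -expr2 enorm_sqr -dotv_mulmx.
apply: le_trans (dotv_CS _ _) _.
by rewrite -mulrA mulrCA ler_wpM2l ?enorm_ge0.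
Qed.

Lemma opboundM m n p (A : 'M[R]_(m, n)) (B : 'M[R]_(n, p)) a b :
  0 <= a -> opbound A a -> opbound B b -> opbound (A *m B) (a * b).
Proof.
move=> a_ge0 Aa Bb x; rewrite -mulmxA (le_trans (Aa _)) // -mulrA.
exact: ler_wpM2l.
Qed.

Lemma opboundD m n (A B : 'M[R]_(m, n)) a b :
  opbound A a -> opbound B b -> opbound (A + B) (a + b).
Proof.
by move=> Aa Bb x; rewrite mulmxDl mulrDl (le_trans (enormD _ _)) // lerD.
Qed.

Lemma opboundZ m n (A : 'M[R]_(m, n)) a c :
  opbound A a -> opbound (c *: A) (`|c| * a).
Proof. by move=> Aa x; rewrite -scalemxAl enormZ -mulrA ler_wpM2l. Qed.

Lemma opbound_coord m n (A : 'M[R]_(m, n)) k i j :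
  opbound A k -> `|A i j| <= k.
Proof.
move=> Ak; have := le_trans (enorm_coord _ i) (Ak (delta_mx j 0)).
rewrite -colE mxE.
suff -> : enorm (delta_mx j 0 : 'cV[R]_n) = 1 by rewrite mulr1.
rewrite /enorm dotvE (bigD1 j) //= big1 ?mxE ?eqxx ?mulr1 ?addr0 ?sqrtr1 //.
by move=> l lj; rewrite mxE (negbTE lj) mul0r.
Qed.

(** Replaces a spectral argument: Cauchy-Schwarz for the form of [A] at [A x] and [x] gives [|A x|^4
    <= <A x, A A x> <x, A x> <= k |A x|^2 k |x|^2]. *)
Lemma psd_opbound n (A : 'M[R]_n) k : possemidefmx A -> 0 <= k ->
  (forall x, dotv x (A *m x) <= k * dotv x x) -> opbound A k.
Proof.
move=> Apsd k_ge0 Ak x.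
have [Ax0|Ax0] := eqVneq (A *m x) 0.
  by rewrite Ax0 enorm0 mulr_ge0 ?enorm_ge0.
rewrite -(@ler_pXn2r _ 2) ?nnegrE ?mulr_ge0 ?enorm_ge0 // exprMn !enorm_sqr.
have := psd_CS (A *m x) x Apsd.
have := Ak x; have := Ak (A *m x); have := Apsd.2 x.
have : 0 < dotv (A *m x) (A *m x) by rewrite lt_def dotv_eq0 Ax0 dotv_ge0.
set a := dotv (A *m x) (A *m x); set b := dotv (A *m x) (A *m (A *m x)).
set c := dotv x _; set d := dotv x x => a0 c0 bk ck abc.
rewrite -(ler_pM2l a0) -expr2 (le_trans abc) //.
apply: (@le_trans _ _ (k * a * c)); first exact: ler_wpM2r.
rewrite [leRHS](_ : _ = k * a * (k * d)); last by ring.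
by apply: ler_wpM2l => //; rewrite mulr_ge0 // ltW.
Qed.

Lemma posdef_unit n (A : 'M[R]_n) : posdefmx A -> A \in unitmx.
Proof.
case=> A_sym A_pos; rewrite -row_free_unit; apply: inj_row_free => v vA.
apply/eqP; rewrite -[v]trmxK trmx_eq0; apply/contraT => /A_pos.
by rewrite /dotv trmxK mulmxA vA mul0mx mxE ltxx.
Qed.

(* Cauchy-Schwarz in the A-inner product, applied to x and A^-1 x, bounds
   |x|^4 by <A^-1 x, x> <x, A x>. *)
Lemma posdef_coercive n (A : 'M[R]_n) : posdefmx A ->
  exists2 k, 0 < k & forall x, k * dotv x x <= dotv x (A *m x).
Proof.
move=> Apd; have Au := posdef_unit Apd.
have Apsd := posdef_possemidef Apd.
have [k k0 Bk] := opbound_ex (invmx A); exists k^-1; first by rewrite invr_gt0.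
move=> x; have [->|x0] := eqVneq x 0.
  by rewrite mulmx0 dotvE big1 ?mulr0 // => i _; rewrite mxE mul0r.
have d0 : 0 < dotv x x by rewrite lt_def dotv_eq0 x0 dotv_ge0.
rewrite mulrC ler_pdivrMr // -(ler_pM2l d0) -expr2.
have := psd_CS x (invmx A *m x) Apsd; rewrite mulKVmx // => /le_trans; apply.
rewrite mulrCA ler_wpM2l ?Apsd.2 // mulrC -enorm_sqr.
by rewrite (le_trans (dotv_CS _ _)) // expr2 mulrA ler_wpM2r ?enorm_ge0.
Qed.

(** The supremum dominates the value at [x / |x|], because [opbound_ex] bounds the set from
    above. *)
Lemma opnorm_bound m n (A : 'M[R]_(m, n)) : opbound A (opnorm A).
Proof.
have [k k0 Ak] := opbound_ex A => x.
have [->|x0] := eqVneq x 0; first by rewrite mulmx0 !enorm0 mulr0.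
have e0 : 0 < enorm x by rewrite lt_def enorm_eq0 x0 enorm_ge0.
have e1 : enorm ((enorm x)^-1 *: x) = 1.
  by rewrite enormZ gtr0_norm ?invr_gt0 // mulVf ?gt_eqF.
rewrite -ler_pdivrMr // mulrC -[(enorm x)^-1]gtr0_norm ?invr_gt0 //.
rewrite -enormZ scalemxAr; apply: ub_le_sup; last first.
  by exists ((enorm x)^-1 *: x) => //=; rewrite e1.
exists k => _ [y /= y1 <-]; rewrite (le_trans (Ak y)) //.
by rewrite ler_piMr // ltW.
Qed.

Lemma opnorm_le m n (A : 'M[R]_(m, n)) k : 0 <= k ->
  opbound A k -> opnorm A <= k.
Proof.
move=> k0 Ak; apply: ge_sup.
  by exists (enorm (A *m 0)); exists 0 => //=; rewrite enorm0.
by move=> _ [y /= y1 <-]; rewrite (le_trans (Ak y)) // ler_piMr.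
Qed.

Lemma opnorm_ge0 m n (A : 'M[R]_(m, n)) : 0 <= opnorm A.
Proof.
have [k k0 Ak] := opbound_ex A; apply: ub_le_sup.
  exists k => _ [y /= y1 <-]; rewrite (le_trans (Ak y)) //.
  by rewrite ler_piMr // ltW.
by exists 0; rewrite /= ?mulmx0 enorm0.
Qed.

End LinearAlgebra.

(** * Entrywise limits of matrices and the principal square root *)

Section Limits.
Variable R : realType.
Local Open Scope classical_set_scope.

Definition mxcvg m n (u : nat -> 'M[R]_(m, n)) (a : 'M[R]_(m, n)) : Prop :=
  forall i j, u k i j @[k --> \oo] --> a i j.

Lemma mxcvg_cst m n (a : 'M[R]_(m, n)) : mxcvg (fun=> a) a.
Proof. by move=> i j; exact: cvg_cst. Qed.

Lemma mxcvgM m n p (u : nat -> 'M[R]_(m, n)) (v : nat -> 'M[R]_(n, p)) a b :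
  mxcvg u a -> mxcvg v b -> mxcvg (fun k => u k *m v k) (a *m b).
Proof.
move=> ua vb i j; under eq_fun do rewrite mxE.
rewrite mxE; apply: cvg_big => [|l _]; first exact: add_continuous.
by apply: cvgM; [exact: ua|exact: vb].
Qed.

Lemma mxcvg_dotv n (u v : nat -> 'cV[R]_n) a b :
  mxcvg u a -> mxcvg v b -> dotv (u k) (v k) @[k --> \oo] --> dotv a b.
Proof.
move=> ua vb; apply: mxcvgM vb _ _ => i j.
by rewrite mxE; under eq_fun do rewrite mxE; exact: ua.
Qed.

(** Completeness of the reals, entry by entry. The tail estimate [e] is the form in which both the
    contraction and the minimising sequence below control their differences. *)
Lemma cauchy_mxcvg m n (u : nat -> 'M[R]_(m, n)) (e : nat -> R) :
  e k @[k --> \oo] --> 0 ->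
  (forall k d i j, `|u (k + d)%N i j - u k i j| <= e k) ->
  exists a, mxcvg u a.
Proof.
move=> e0 ue.
have cvu i j : cvg (u k i j @[k --> \oo]).
  apply/cauchy_cvgP/cauchy_exP => eps eps0.
  have [K _ eK] := (cvgrPdist_lt _ _).1 e0 _ eps0.
  exists (u K i j); exists K => // l /= Kl.
  rewrite /ball /= distrC -(subnKC Kl) (le_lt_trans (ue _ _ _ _)) //.
  by have := eK K (leqnn K); rewrite /= sub0r normrN; apply/le_lt_trans/ler_norm.
exists (\matrix_(i, j) lim (u k i j @[k --> \oo])) => i j.
by rewrite mxE; exact: cvu.
Qed.

(* Writing 1 - E = (1 - X)^2 amounts to X = (E + X^2) / 2; the iteration of
   this map from 0 stays in the ball of radius rho = 1 - sqrt (1 - q), where it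
   is a contraction of ratio rho < 1. *)
Lemma sqrt_one_sub n (E : 'M[R]_n) q : 0 <= q < 1 -> E^T = E ->
  opbound E q -> exists B, possemidefmx B /\ B *m B = 1%:M - E.
Proof.
move=> /andP[q0 q1] E_sym Eq.
pose rho := 1 - Num.sqrt (1 - q).
have sq : Num.sqrt (1 - q) ^+ 2 = 1 - q by rewrite sqr_sqrtr // subr_ge0 ltW.
have s0 : 0 < Num.sqrt (1 - q) by rewrite sqrtr_gt0 subr_gt0.
(* [rho] is the smaller root of [s^2 - 2 s + q], the scalar fixed point of the iteration, so the
   bound [rho] reproduces itself. *)
have rhoE : q + rho * rho = 2 * rho by rewrite /rho; nra.
have rho0 : 0 <= rho by nra.
have rho1 : rho < 1 by rewrite /rho; lra.
pose X := fix X k := if k is k'.+1 then 2^-1 *: (E + X k' *m X k') else 0.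
have Xrho k : opbound (X k) rho.
  elim: k => [|k IH] /=; first by move=> x; rewrite mul0mx enorm0 mulr_ge0 ?enorm_ge0.
  have := opboundZ 2^-1 (opboundD Eq (opboundM rho0 IH IH)).
  by rewrite rhoE gtr0_norm // mulKf.
have X_sym k : (X k)^T = X k.
  elim: k => [|k IH] /=; first by rewrite trmx0.
  by rewrite linearZ linearD /= trmx_mul IH E_sym.
have XB k d : opbound (X (k + d)%N - X k) (rho ^+ k).
  elim: k => [|k IH].
    rewrite add0n subr0 expr0 => x; rewrite (le_trans (Xrho d x)) //.
    by rewrite ler_wpM2r ?enorm_ge0 // ltW.
  (* A difference of squares split without commutation: [Y^2 - X^2 = Y (Y - X) + (Y - X) X]. *)
  have -> : X (k.+1 + d)%N - X k.+1 = 2^-1 *: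
      (X (k + d)%N *m (X (k + d)%N - X k) + (X (k + d)%N - X k) *m X k).
    rewrite addSn /= mulmxBr mulmxBl -scalerBr addrA subrK.
    by congr (_ *: _); rewrite opprD addrACA subrr add0r.
  have rk : 0 <= rho ^+ k by rewrite exprn_ge0.
  have := opboundZ 2^-1 (opboundD (opboundM rho0 (Xrho (k + d)%N) IH)
    (opboundM rk IH (Xrho k))).
  rewrite gtr0_norm // exprS.
  by have -> : 2^-1 * (rho * rho ^+ k + rho ^+ k * rho) = rho * rho ^+ k by field.
have [||a Xa] := @cauchy_mxcvg _ _ X (fun k => rho ^+ k).
- by apply: cvg_expr; rewrite ger0_norm.
- by move=> k d i j; have := opbound_coord i j (XB k d); rewrite !mxE.
have aE : a = 2^-1 *: (E + a *m a).
  apply/matrixP => i j.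
  have XS : X k.+1 i j @[k --> \oo] --> a i j.
    by have := Xa i j; rewrite -(cvg_shiftS (fun k => X k i j)).
  apply: (cvg_unique _ XS) => //.
  have -> : (fun k => X k.+1 i j) =
      (fun k => 2^-1 * (E i j + (X k *m X k) i j)).
    by apply/funext => k; rewrite mxE mxE.
  rewrite mxE mxE; apply: cvgMl_tmp; apply: cvgD; first exact: cvg_cst.
  exact: mxcvgM.
have a_sym : a^T = a.
  apply/matrixP => i j; rewrite mxE.
  apply: (cvg_unique _ (Xa j i)) => //.
  have -> : (fun k => X k j i) = (fun k => X k i j).
    by apply/funext => k; rewrite -{1}X_sym mxE.
  exact: Xa.
exists (1%:M - a); split; last first.
  rewrite mulmxBl !mulmxBr !mul1mx mulmx1.
  have : E + a *m a = a + a.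
    rewrite {3 4}aE -scalerDl (_ : 2^-1 + 2^-1 = 1 :> R) ?scale1r //.
    by field.
  move=> /(canRL (addrK _)) ->.
  by rewrite !opprB opprD -addrA [- a + _]addrCA.
split=> [|x]; first by rewrite linearB /= trmx1 a_sym.
(* There remains [<x, a x> <= <x, x>], inherited in the limit from the iterates, whose bound [rho]
   is below 1. *)
rewrite mulmxBl mul1mx dotvDr dotvNr subr_ge0.
have cstx : mxcvg (fun=> x) x by exact: mxcvg_cst.
have cx := mxcvg_dotv cstx (mxcvgM Xa cstx).
apply: cvgr_to_le cx _; apply: nearW => k.
rewrite (le_trans (dotv_CS _ _)) // -enorm_sqr expr2 ler_wpM2l ?enorm_ge0 //.
by rewrite (le_trans (Xrho k x)) // ler_piMl ?enorm_ge0 // ltW.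
Qed.

(** With an upper bound [K] and a coercivity constant [l] of [P], the matrix [E = 1 - P / K] has
    norm at most [q < 1], so [P / K = 1 - E] has a root, to be scaled by [sqrt K]. Hence [xget] in
    [sqrtmx] does not return its default. *)
Lemma sqrtmx_posdef n (P : 'M[R]_n) : posdefmx P ->
  possemidefmx (sqrtmx P) /\ sqrtmx P *m sqrtmx P = P.
Proof.
move=> Ppd; apply: (@xgetPex _ 0 [set B | possemidefmx B /\ B *m B = P]).
have [K K0 PK] := opbound_ex P.
have [l l0 Pl] := posdef_coercive Ppd.
pose E := 1%:M - K^-1 *: P.
have E_sym : E^T = E by rewrite /E linearB linearZ /= trmx1 Ppd.1.
have dE x : dotv x (E *m x) = dotv x x - K^-1 * dotv x (P *m x).
  by rewrite /E mulmxBl mul1mx -scalemxAl !dotvlin.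
(* The maximum matters in dimension 0, where [l <= K] may fail. *)
pose q := Num.max 0 (1 - K^-1 * l).
have q0 : 0 <= q by rewrite /q le_max lexx.
have q1 : q < 1.
  by rewrite /q gt_max ltr01 /= ltrBlDr ltrDl mulr_gt0 ?invr_gt0.
have [|||B [Bpsd BB]] := @sqrt_one_sub n E q.
- by rewrite q0.
- exact: E_sym.
- apply: psd_opbound => // [|x].
    split=> // x; rewrite dE subr_ge0 mulrC ler_pdivrMr //.
    rewrite (le_trans (dotv_CS _ _)) // -enorm_sqr expr2 -mulrA.
    by rewrite ler_wpM2l ?enorm_ge0 // mulrC.
  rewrite dE (@le_trans _ _ ((1 - K^-1 * l) * dotv x x)) //; last first.
    by rewrite ler_wpM2r ?dotv_ge0 // /q le_max lexx orbT.
  by rewrite mulrBl mul1r lerB // -mulrA ler_wpM2l ?invr_ge0 ?Pl // ltW.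
exists (Num.sqrt K *: B); split.
  split=> [|x]; first by rewrite linearZ /= Bpsd.1.
  by rewrite -scalemxAl dotvZr mulr_ge0 ?sqrtr_ge0 // Bpsd.2.
rewrite -scalemxAl -scalemxAr scalerA -expr2 sqr_sqrtr 1?ltW // BB /E.
by rewrite opprB addrCA subrr addr0 scalerA divff ?scale1r // gt_eqF.
Qed.

End Limits.

(** * Subgradients, existence of the proximal point and firm nonexpansiveness *)

Section Prox.
Variables (R : realType) (n : nat).
Implicit Types (h : 'cV[R]_n -> \bar R) (V : 'M[R]_n) (x p z w g : 'cV[R]_n).
Local Open Scope classical_set_scope.

Definition subgrad h p g : Prop :=
  forall w, (h p + (dotv g (w - p))%:E <= h w)%E.

Lemma proper_fin h z : proper_fun h -> (h z < +oo)%E -> exists r, h z = r%:E.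
Proof. by case=> /(_ z); case: (h z) => // r _ _ _; exists r. Qed.

(** If [h p] were infinite, the subgradient inequality at a point of the domain would fail. *)
Lemma subgrad_fin h p g : proper_fun h -> subgrad h p g -> exists r, h p = r%:E.
Proof.
move=> hp sg; apply: proper_fin => //; case: hp => _ [w hw].
rewrite ltey; apply/eqP => hpoo; have := sg w.
by rewrite hpoo addye // leye_eq => /eqP hwoo; rewrite hwoo in hw.
Qed.

Lemma sqnormVB V x p w : V^T = V ->
  sqnormV V (x - w) =
  sqnormV V (x - p) - 2 * dotv (V *m (x - p)) (w - p) + sqnormV V (w - p).
Proof.
move=> V_sym; have -> : x - w = (x - p) - (w - p) by rewrite opprB addrA subrK.
rewrite /sqnormV; move: (x - p) (w - p) => a b.
by rewrite !dotvlin (dotvC _ b) (dotv_sym a b V_sym); ring.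
Qed.

(** The parallelogram identity, which will make minimising sequences Cauchy. The weight [1 - 2^-1]
    is kept to match [convex_efun]. *)
Lemma sqnormV_mid V x u v : V^T = V ->
  sqnormV V (x - (2^-1 *: u + (1 - 2^-1) *: v)) =
  2^-1 * sqnormV V (x - u) + 2^-1 * sqnormV V (x - v)
  - 2^-1 * 2^-1 * sqnormV V (u - v).
Proof.
move=> V_sym.
rewrite (sqnormVB x v u V_sym) (sqnormVB x v (_ + _) V_sym).
have -> : 2^-1 *: u + (1 - 2^-1) *: v - v = 2^-1 *: (u - v).
  by rewrite scalerBl scale1r scalerBr addrA addrAC addrK.
have -> : sqnormV V (2^-1 *: (u - v)) = 2^-1 * (2^-1 * sqnormV V (u - v)).
  by rewrite /sqnormV -scalemxAr dotvZl dotvZr.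
by rewrite dotvZr; field.
Qed.

(** Expanding the quadratic term around [p] turns the subgradient inequality into quadratic growth
    of the objective, [f p + |w - p|_V^2 / 2 <= f w]. This yields minimality and uniqueness, hence
    the point chosen by [xget]. *)
Lemma proxV_subgrad V h x p : proper_fun h -> posdefmx V ->
  subgrad h p (V *m (x - p)) -> proxV V h x = p.
Proof.
move=> hprop Vpd sg; have [r hr] := subgrad_fin hprop sg.
have Vpsd := posdef_possemidef Vpd.
have key w : (h p + (2^-1 * sqnormV V (x - p))%:E
    + (2^-1 * sqnormV V (w - p))%:E <= h w + (2^-1 * sqnormV V (x - w))%:E)%E.
  have := sg w; have := hprop.1 w; rewrite hr.
  case: (h w) => [s| |] //= _; last by rewrite addye ?leey.
  rewrite -!EFinD !lee_fin (sqnormVB x p w Vpd.1); lra.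
rewrite /proxV; apply: xget_unique => [w|w wmin].
  apply: le_trans (key w); rewrite hr -!EFinD lee_fin lerDl mulr_ge0 ?invr_ge0 //.
  exact: Vpsd.2.
have := le_trans (key w) (wmin p); rewrite hr -!EFinD lee_fin.
rewrite gerDl => wp; apply/eqP; rewrite -subr_eq0; apply/contraT => /Vpd.2.
by rewrite -/(sqnormV _ _); lra.
Qed.

Lemma convex_fin h x y (a b t : R) : proper_fun h -> convex_efun h ->
  h x = a%:E -> h y = b%:E -> 0 < t < 1 ->
  exists2 c, h (t *: x + (1 - t) *: y) = c%:E & c <= t * a + (1 - t) * b.
Proof.
move=> hprop hconv hx hy t01; have := hconv x y t t01.
have := hprop.1 (t *: x + (1 - t) *: y); rewrite hx hy -!EFinM -EFinD.
by case: (h _) => // c _; rewrite lee_fin => cle; exists c.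
Qed.

(** Compare [p] with [t w + (1 - t) p] and divide by [t]: convexity leaves the subgradient
    inequality up to an error [t q / 2], which can be made arbitrarily small. *)
Lemma argmin_subgrad V h x p : proper_fun h -> convex_efun h -> posdefmx V ->
  argmin (fun z => h z + (2^-1 * sqnormV V (x - z))%:E)%E p ->
  subgrad h p (V *m (x - p)).
Proof.
move=> hprop hconv Vpd pmin w.
have [r hr] : exists r, h p = r%:E.
  apply: proper_fin => //; case: (hprop) => _ [y hy].
  have := pmin y; have := hprop.1 y.
  by case: (h y) hy => // s _ _; case: (h p) => //= s'; rewrite ?ltry.
rewrite hr; have := hprop.1 w; case hw: (h w) => [s| |] // _; last by rewrite leey.
rewrite -EFinD lee_fin; apply/ler_addgt0Pr => e e0.
pose q := sqnormV V (w - p).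
have q0 : 0 <= q by exact: (posdef_possemidef Vpd).2.
(* The bound 1/2 keeps [t] below 1; [q + 1] avoids a division by zero and still gives [t q <= e]. *)
pose t := Num.min 2^-1 (e / (q + 1)).
have q1 : 0 < q + 1 by rewrite ltr_wpDl.
have t0 : 0 < t by rewrite /t lt_min invr_gt0 ltr0n divr_gt0.
have t1 : t < 1 by rewrite /t gt_min invf_lt1 ?ltr1n.
have tq : t * q <= e.
  rewrite (@le_trans _ _ (t * (q + 1))) //.
    by apply: ler_wpM2l; [exact: ltW|rewrite lerDl].
  by rewrite -ler_pdivlMr // /t ge_min lexx orbT.
have [|c hc cle] := convex_fin hprop hconv hw hr (t := t); first by rewrite t0.
have := pmin (t *: w + (1 - t) *: p); rewrite hr hc -!EFinD lee_fin.
rewrite (sqnormVB x p (t *: w + (1 - t) *: p) Vpd.1).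
have -> : t *: w + (1 - t) *: p - p = t *: (w - p).
  by rewrite scalerBl scale1r scalerBr addrA addrAC addrK.
have -> : sqnormV V (t *: (w - p)) = t * (t * q).
  by rewrite /q /sqnormV -scalemxAr dotvZl dotvZr.
rewrite dotvZr => H; rewrite -(ler_pM2l t0).
have : t * (t * q) <= t * e by rewrite ler_pM2l.
have : 0 <= t * e by rewrite mulr_ge0 ?ltW.
move: (dotv _ _) H cle => d; lra.
Qed.

(** Neighbourhoods come from sup-norm balls, and each coordinate is bounded by the Euclidean
    norm. *)
Lemma nbhs_enorm x (A : set 'cV[R]_n) : nbhs x A ->
  exists2 d, 0 < d & forall y, enorm (y - x) < d -> A y.
Proof.
move=> /nbhs_ballP [d /= d0 dA]; exists d => // y xy; apply: dA.
split=> // i j; rewrite ord1 /ball /= distrC.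
by have := enorm_coord (y - x) i; rewrite !mxE => /le_lt_trans; apply.
Qed.

Lemma mxcvg_nbhs (z_ : nat -> 'cV[R]_n) z (A : set 'cV[R]_n) :
  mxcvg z_ z -> nbhs z A -> \forall k \near \oo, A (z_ k).
Proof.
move=> zz /nbhs_enorm [d d0 dA].
have cvB : mxcvg (fun k => z_ k - z) (z - z).
  move=> i j; rewrite !mxE; under eq_fun do rewrite !mxE.
  by apply: cvgB; [exact: zz|exact: cvg_cst].
have := mxcvg_dotv cvB cvB; rewrite subrr.
have -> : dotv (0 : 'cV[R]_n) 0 = 0 by apply/eqP; rewrite dotv_eq0.
move=> /cvgrPdist_lt /(_ (d ^+ 2)); rewrite exprn_gt0 // => /(_ isT).
apply: filterS => k; rewrite sub0r normrN ger0_norm ?dotv_ge0 // -enorm_sqr.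
by rewrite ltr_pXn2r ?nnegrE ?enorm_ge0 ?(ltW d0) // => /dA.
Qed.

(* Lower semicontinuity gives h > h x0 - 1 near x0, and convexity along the
   segment from x0 to z propagates this to a linear lower bound. *)
Lemma convex_lsc_minorant h x0 (a : R) : Gamma0 h -> h x0 = a%:E ->
  exists2 c, 0 <= c & forall z (r : R), h z = r%:E ->
    a - 1 - c * enorm (z - x0) <= r.
Proof.
case=> hprop hlsc hconv hx0.
have [|A /nbhs_enorm [d d0 dA] Ah] := hlsc x0 (a - 1).
  by rewrite hx0 lte_fin; lra.
exists (2 / d) => [|z r hz]; first by rewrite divr_ge0 // ltW.
have [zd|dz] := ltP (enorm (z - x0)) d.
  have := Ah _ (dA _ zd); rewrite hz lte_fin.
  have : 0 <= 2 / d * enorm (z - x0).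
    by rewrite mulr_ge0 ?enorm_ge0 ?divr_ge0 // ltW.
  lra.
set e := enorm (z - x0) in dz *.
have e0 : 0 < e by exact: lt_le_trans dz.
(* Puts the point of the segment at distance [d / 2] from [x0], where [h > a - 1]; since
   [1 / t = (2 / d) e], the slope is [2 / d]. *)
pose t := d / 2 / e.
have t0 : 0 < t by rewrite !divr_gt0.
have t1 : t < 1 by rewrite ltr_pdivrMr // mul1r; lra.
have [|c hc cle] := convex_fin hprop hconv hz hx0 (t := t); first by rewrite t0.
have : ((a - 1)%:E < h (t *: z + (1 - t) *: x0)%R)%E.
  apply/Ah/dA.
  have -> : t *: z + (1 - t) *: x0 - x0 = t *: (z - x0).
    by rewrite scalerBl scale1r scalerBr addrA addrAC addrK.
  by rewrite enormZ gtr0_norm // /t divfK ?gt_eqF //; lra.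
rewrite hc lte_fin => ac.
have -> : 2 / d * e = t^-1 by rewrite /t; field; rewrite !gt_eqF.
rewrite -(ler_pM2l t0) mulrBr divff ?gt_eqF //; lra.
Qed.

(** Direct method without compactness: the linear minorant and coercivity bound the objective below,
    strong convexity makes a minimising sequence Cauchy, and lower semicontinuity shows that its
    limit is a minimiser. *)
Lemma argmin_ex V h x : Gamma0 h -> posdefmx V ->
  exists p, argmin (fun z => h z + (2^-1 * sqnormV V (x - z))%:E)%E p.
Proof.
move=> hG Vpd; case: (hG) => hprop hlsc hconv.
have [x0 /(proper_fin hprop) [a ha]] := hprop.2.
have [c c0 hlow] := convex_lsc_minorant hG ha.
have [l l0 Vl] := posdef_coercive Vpd.
(* Only points where [h] is finite enter, so the infimum is taken in the reals. *)
pose S : set R := [set s | exists z r, h z = r%:E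
  /\ s = r + 2^-1 * sqnormV V (x - z)].
have S_lb : has_lbound S.
  (* Completing the square: [l s^2 / 2 - c s >= - c^2 / (2 l)] for [s = |x - z|]. *)
  exists (a - 1 - c * enorm (x - x0) - c ^+ 2 / (2 * l)).
  move=> _ [z [r [hz ->]]].
  have := hlow z r hz; have := Vl (x - z); rewrite -enorm_sqr -/(sqnormV _ _).
  have : enorm (z - x0) <= enorm (x - z) + enorm (x - x0).
    rewrite -enormN (_ : - (z - x0) = (x - z) - (x - x0)).
      by rewrite (le_trans (enormD _ _)) // enormN.
    by rewrite !opprB [RHS]addrC addrA subrK.
  move=> /(ler_wpM2l c0); rewrite mulrDr.
  have : 0 <= (l * enorm (x - z) - c) ^+ 2 / (2 * l).
    by rewrite divr_ge0 ?sqr_ge0 // mulr_ge0 // ltW.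
  have -> : (l * enorm (x - z) - c) ^+ 2 / (2 * l) =
      2^-1 * (l * enorm (x - z) ^+ 2) - c * enorm (x - z) + c ^+ 2 / (2 * l).
    by field; rewrite gt_eqF.
  lra.
have S_inf : has_inf S.
  by split=> //; exists (a + 2^-1 * sqnormV V (x - x0)), x0, a.
pose m := inf S.
have m_le z r : h z = r%:E -> m <= r + 2^-1 * sqnormV V (x - z).
  by move=> hz; apply: ge_inf => //; exists z, r.
have zr_ex (k : nat) : exists zr : 'cV[R]_n * R,
    h zr.1 = zr.2%:E /\ zr.2 + 2^-1 * sqnormV V (x - zr.1) < m + harmonic k.
  have [|_ [z [r [hz ->]]] lt] := @inf_adherent _ S (harmonic k) _ S_inf.
    exact: harmonic_gt0.
  by exists (z, r).
have [zr zrP] := choice zr_ex.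
(* The midpoint has value at least [m], while both ends are below [m + harmonic k]; the midpoint
   identity then leaves an eighth of the squared distance below [harmonic k]. *)
have zV k d : sqnormV V ((zr (k + d)%N).1 - (zr k).1) <= 8 * harmonic k.
  have [hk klt] := zrP k; have [hl llt] := zrP (k + d)%N.
  have [|s hs sle] := convex_fin hprop hconv hl hk (t := 2^-1); first by lra.
  have hh : harmonic (k + d)%N <= harmonic k :> R.
    by rewrite /= lef_pV2 ?posrE ?ltr0n // ler_nat ltnS leq_addr.
  have := m_le _ _ hs.
  rewrite (sqnormV_mid _ _ _ Vpd.1); lra.
have [||z zz] := @cauchy_mxcvg _ _ _ (fun k => (zr k).1)
  (fun k => Num.sqrt (8 * harmonic k / l)).
- rewrite -[X in _ --> X](@sqrtr0 R).
  apply: continuous_cvg; first exact: sqrt_continuous.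
  rewrite -[X in _ --> X](mul0r l^-1); apply: cvgMr_tmp.
  rewrite -[X in _ --> X](mulr0 8); apply: cvgMl_tmp; exact: cvg_harmonic.
- move=> k d i j; rewrite ord1.
  have := enorm_coord ((zr (k + d)%N).1 - (zr k).1) i; rewrite !mxE.
  move=> /le_trans; apply; rewrite ler_wsqrtr // ler_pdivlMr // mulrC.
  exact: le_trans (Vl _) (zV k d).
have zlow : (h z <= (m - 2^-1 * sqnormV V (x - z))%:E)%E.
  rewrite leNgt; apply/negP => lth.
  (* Lower semicontinuity is tested at a real level, so [b] is a midpoint when [h z] is finite and
     any larger real when [h z = +oo]. Then [h > b] along the tail of the sequence contradicts the
     limit of its upper bounds. *)
  have [b blt hb] : exists2 b, m - 2^-1 * sqnormV V (x - z) < b & (b%:E < h z)%E.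
    case: (h z) lth => [s| |] //; last by exists (m - 2^-1 * sqnormV V (x - z) + 1);
      rewrite ?ltry // ltrDl.
    rewrite lte_fin => ms.
    by exists (((m - 2^-1 * sqnormV V (x - z)) + s) / 2);
      rewrite ?lte_fin ?midf_lt.
  have [A zA Ah] := hlsc z b hb.
  suff : b <= m - 2^-1 * sqnormV V (x - z) by rewrite leNgt blt.
  have xzz : mxcvg (fun k => x - (zr k).1) (x - z).
    move=> i j; rewrite !mxE; under eq_fun do rewrite !mxE.
    by apply: cvgB; [exact: cvg_cst|exact: zz].
  have cVx : mxcvg (fun k => V *m (x - (zr k).1)) (V *m (x - z)).
    by apply: mxcvgM xzz; exact: mxcvg_cst.
  have : m + harmonic k - 2^-1 * sqnormV V (x - (zr k).1) @[k --> \oo]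
      --> m + 0 - 2^-1 * sqnormV V (x - z).
    apply: cvgB; first by apply: cvgD; [exact: cvg_cst|exact: cvg_harmonic].
    by apply: cvgMl_tmp; exact: mxcvg_dotv.
  rewrite addr0 => /(ler_cvg_to (cvg_cst b)); apply.
  apply: filterS (mxcvg_nbhs zz zA) => k /Ah.
  have [-> klt] := zrP k; rewrite lte_fin; lra.
exists z => w; have := hprop.1 w; case hw: (h w) => [s| |] // _; last first.
  by rewrite addye // leey.
apply: (@le_trans _ _ m%:E); last by rewrite -EFinD lee_fin m_le.
by rewrite -leeBrDr // -EFinB.
Qed.

Lemma subgrad_proxV V h x : Gamma0 h -> posdefmx V ->
  subgrad h (proxV V h x) (V *m (x - proxV V h x)).
Proof.
move=> hG Vpd; case: (hG) => hprop _ hconv; apply: argmin_subgrad => //.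
by rewrite /proxV; apply: xgetPex; exact: argmin_ex.
Qed.

(** Add the subgradient inequalities at the two proximal points, each tested at the other; the
    values of [h] cancel. *)
Lemma proxV_firm V h x y : Gamma0 h -> posdefmx V ->
  sqnormV V (proxV V h x - proxV V h y)
  <= dotv (V *m (x - y)) (proxV V h x - proxV V h y).
Proof.
move=> hG Vpd; case: (hG) => hprop _ _.
have sx := subgrad_proxV x hG Vpd; have sy := subgrad_proxV y hG Vpd.
have [a ha] := subgrad_fin hprop sx; have [b hb] := subgrad_fin hprop sy.
have := sx (proxV V h y); have := sy (proxV V h x).
move: (proxV V h x) (proxV V h y) ha hb => p q ha hb.
rewrite ha hb -!EFinD !lee_fin /sqnormV.
rewrite (dotvC (p - q)) !dotvlin; lra.
Qed.

End Prox.

(** * Change of variables by a square root of the metric, and the norm bound for [P - U U^T] *)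

Section ScaledProx.
Variables (R : realType) (n : nat).
Implicit Types (h : 'cV[R]_n -> \bar R) (S P : 'M[R]_n).

Lemma mulmx_subD r (A : 'M[R]_(r, n)) (x y z : 'cV[R]_n) (a b : 'cV[R]_r) :
  A *m (x - y) + a - (A *m (x - z) + b) = a - b - A *m (y - z).
Proof.
rewrite !mulmxBr; move: (A *m x) (A *m y) (A *m z) => u v w.
rewrite opprD (opprB u w) (opprB v w) [u - v + a]addrC [w - u - b]addrC addrACA.
by congr (_ + _); rewrite addrC addrA subrK.
Qed.

Lemma posdef1 : posdefmx (1%:M : 'M[R]_n).
Proof.
split=> [|x x0]; first exact: trmx1.
by rewrite mul1mx lt_def dotv_eq0 x0 dotv_ge0.
Qed.

(** Under [w = S z] the optimality condition is preserved: with [p] the proximal point, [<P (y - p),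
    z - p> = <S y - S p, w - S p>]. *)
Lemma prox_scaled h P S y : Gamma0 h -> posdefmx P -> S^T = S -> S *m S = P ->
  invmx S *m prox (fun z => h (invmx S *m z)) (S *m y) = proxV P h y.
Proof.
move=> hG Ppd S_sym SS.
have Su : S \in unitmx.
  by have := posdef_unit Ppd; rewrite -SS unitmx_mul => /andP[].
suff -> : prox (fun z => h (invmx S *m z)) (S *m y) = S *m proxV P h y.
  by rewrite mulKmx.
apply: proxV_subgrad; last 2 first.
- exact: posdef1.
- move=> w; have := subgrad_proxV y hG Ppd (invmx S *m w).
  move: (proxV P h y) => p; rewrite mulKmx // mul1mx -SS.
  have -> // : dotv (S *m S *m (y - p)) (invmx S *m w - p)
             = dotv (S *m y - S *m p) (w - S *m p).
  rewrite -mulmxA -{1}S_sym -dotv_mulmx (mulmxBr S (invmx S *m w)) mulKVmx //.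
  by rewrite mulmxBr.
case: hG => -[hNoo [w hw]] _ _; split=> //.
by exists (S *m w); rewrite mulKmx.
Qed.

(** [P - U U^T = S (1 - W W^T) S] with [W = S^-1 U], so [1 - W W^T] is coercive with some constant
    [l]. Then [|W^T y|^2 <= (1 - l) |y|^2], and transposition carries the bound to [W]. *)
Lemma opnorm_lt1 r P S (U : 'M[R]_(n, r)) : posdefmx P -> S^T = S ->
  S *m S = P -> posdefmx (P - U *m U^T) -> opnorm (invmx S *m U) ^+ 2 < 1.
Proof.
move=> Ppd S_sym SS Vpd; set W := invmx S *m U.
have Su : S \in unitmx.
  by have := posdef_unit Ppd; rewrite -SS unitmx_mul => /andP[].
have SW : S *m W = U by rewrite /W mulKVmx.
have Mpd : posdefmx (1%:M - W *m W^T).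
  split=> [|y y0]; first by rewrite linearB /= trmx1 trmx_mul trmxK.
  have -> : dotv y ((1%:M - W *m W^T) *m y) =
      dotv (invmx S *m y) ((P - U *m U^T) *m (invmx S *m y)).
    have E : P - U *m U^T = S *m (1%:M - W *m W^T) *m S.
      by rewrite mulmxBr mulmxBl mulmx1 SS -SW trmx_mul S_sym !mulmxA.
    by rewrite E -!mulmxA mulKVmx // dotv_mulmx S_sym mulKVmx // mulmxA.
  apply: Vpd.2; apply: contraNneq y0 => Sy.
  by rewrite -[y](mulKVmx Su) Sy mulmx0.
have [l l0 Ml] := posdef_coercive Mpd.
pose k := Num.max 0 (1 - l).
have k0 : 0 <= k by rewrite /k le_max lexx.
have k1 : k < 1 by rewrite /k gt_max ltr01 /= ltrBlDr ltrDl.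
suff Wk : opbound W (Num.sqrt k).
  apply: le_lt_trans k1; rewrite -[leRHS]sqr_sqrtr //.
  by rewrite ler_pXn2r ?nnegrE ?opnorm_ge0 ?sqrtr_ge0 // opnorm_le ?sqrtr_ge0.
rewrite -[W]trmxK; apply: opbound_tr => [|y]; first exact: sqrtr_ge0.
rewrite -(@ler_pXn2r _ 2) ?nnegrE ?mulr_ge0 ?enorm_ge0 ?sqrtr_ge0 //.
rewrite exprMn (sqr_sqrtr k0) !enorm_sqr.
apply: (@le_trans _ _ ((1 - l) * dotv y y)); last first.
  by rewrite ler_wpM2r ?dotv_ge0 // /k le_max lexx orbT.
have := Ml y; rewrite mulmxBl mul1mx -mulmxA !dotvlin (dotv_mulmx W); lra.
Qed.

End ScaledProx.

(** * The reduced mapping [L]: its estimates and its zero *)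

Theorem theorem3p4 (R : realType) (N r : nat) (h : 'cV[R]_N -> \bar R)
    (P Q V : 'M[R]_N) (u : 'I_r -> 'cV[R]_N) (plus : bool)
    (hGamma0 : Gamma0 h)
    (Ppd : posdefmx P)
    (QE : Q = \sum_(i < r) u i *m (u i)^T)
    (rE : r = \rank Q) (rN : (r <= N)%N)
    (VE : V = pm plus P Q)
    (Vpd : posdefmx V) :
  let U : 'M[R]_(N, r) := \matrix_(i < N, j < r) u j i 0 in
  let sqrtP : 'M[R]_N := sqrtmx P in
  let isqrtP : 'M[R]_N := invmx sqrtP in
  let h' : 'cV[R]_N -> \bar R := fun z => h (isqrtP *m z) in
  let c : R := if plus then 1 else 1 - opnorm (isqrtP *m U) ^+ 2 in
  forall x : 'cV[R]_N,
  let shift (alpha : 'cV[R]_r) : 'cV[R]_N :=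
    mp plus x (invmx P *m U *m alpha) in
  let L (alpha : 'cV[R]_r) : 'cV[R]_r :=
    U^T *m (x - isqrtP *m prox h' (sqrtP *m shift alpha)) + alpha in
  (forall alpha, L alpha = U^T *m (x - proxV P h (shift alpha)) + alpha) /\
  (exists alphastar : 'cV[R]_r,
    [/\ unique (fun alpha => L alpha = 0) alphastar,
        proxV V h x = isqrtP *m prox h' (sqrtP *m shift alphastar) &
        isqrtP *m prox h' (sqrtP *m shift alphastar)
          = proxV P h (shift alphastar)]) /\
  lipschitz_with (1 + opnorm (isqrtP *m U) ^+ 2) L /\
  strongly_monotone c L.
Proof.
move=> U S iS h' c x shift L.
have [[S_sym _] SS] := sqrtmx_posdef Ppd; rewrite -/S in S_sym SS.
have Pu := posdef_unit Ppd.
have Su : S \in unitmx by move: Pu; rewrite -SS unitmx_mul => /andP[].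
pose T y := proxV P h y.
have TE y : iS *m prox h' (S *m y) = T y by exact: prox_scaled.
have LE a : L a = U^T *m (x - T (shift a)) + a by rewrite /L TE.
have QU : Q = U *m U^T.
  rewrite QE; apply/matrixP => i j; rewrite summxE mxE.
  by apply: eq_bigr => k _; rewrite !mxE big_ord1 !mxE.
set W := iS *m U in c *.
have SW : S *m W = U by rewrite /W /iS mulKVmx.
(* [- pm plus 0 v] is [- v] for the upper sign and [v] for the lower one, so both cases share one
   formula. *)
have Pshift a b : P *m (shift a - shift b) = - pm plus 0 (U *m (a - b)).
  rewrite /shift /mp /pm -!mulmxA; case: ifP => _.
    rewrite add0r opprB [x - _ + _]addrC addrA subrK.
    by rewrite -!mulmxBr mulKVmx // -mulmxN opprB.
  rewrite sub0r opprK [x + _]addrC addrKA.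
  by rewrite -!mulmxBr mulKVmx.
(* Firm nonexpansiveness of T, written in the variable S (T a - T b). *)
have firm a b : let D := S *m (T (shift a) - T (shift b)) in
    dotv D D <= - pm plus 0 (dotv (W *m (a - b)) D).
  have := proxV_firm (shift a) (shift b) hGamma0 Ppd; rewrite -/(T _) -/(T _) /=.
  move: (T _ - T _) => D; rewrite Pshift /sqnormV -SS -SW.
  rewrite -mulmxA dotv_mulmx S_sym -mulmxA => /le_trans; apply.
  rewrite /pm; case: ifP => _;
    by rewrite ?add0r ?sub0r ?opprK ?dotvNl -{1}S_sym -dotv_mulmx.
have LB a b : L a - L b = a - b - W^T *m (S *m (T (shift a) - T (shift b))).
  have -> D : W^T *m (S *m D) = U^T *m D.
    by rewrite mulmxA -{1}S_sym -trmx_mul SW.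
  rewrite (LE a) (LE b); exact: mulmx_subD.
(* Cauchy-Schwarz in [firm] gives [|D|^2 <= |W (a - b)| |D|] for either sign. *)
have DW a b : enorm (S *m (T (shift a) - T (shift b))) <= enorm (W *m (a - b)).
  have := firm a b; rewrite /=; move: (S *m _) => D DD.
  have [->|D0] := eqVneq D 0; first by rewrite enorm0 enorm_ge0.
  have D_gt0 : 0 < enorm D by rewrite lt_def enorm_eq0 D0 enorm_ge0.
  rewrite -(ler_pM2r D_gt0) -expr2 enorm_sqr (le_trans DD) // /pm.
  case: ifP => _; last by rewrite sub0r opprK dotv_CS.
  by rewrite add0r -dotvNl -(enormN (W *m _)) dotv_CS.
(* With [d = a - b], the product is [|d|^2 - <W d, D>]. For the upper sign [firm] gives
   [- <W d, D> >= |D|^2 >= 0]; for the lower one [<W d, D> <= |W d|^2] by [DW]. *)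
have Lmono a b : c * enorm (a - b) ^+ 2 <= dotv (L a - L b) (a - b).
  have := firm a b; have := DW a b; rewrite LB /=.
  move: (S *m _) (a - b) => D d DWd.
  rewrite dotvDl dotvNl -dotv_mulmx (dotvC D) /pm /c.
  case: ifP => _; first by rewrite enorm_sqr; have := dotv_ge0 D; lra.
  have : dotv (W *m d) D <= opnorm W ^+ 2 * enorm d ^+ 2.
    rewrite (le_trans (dotv_CS _ _)) // -exprMn expr2.
    have Wd := opnorm_bound W d.
    by rewrite ler_pM ?enorm_ge0 // (le_trans DWd).
  by rewrite -(enorm_sqr d); lra.
have c0 : 0 < c.
  rewrite /c; case: ifPn => // plusF.
  rewrite subr_gt0; apply: opnorm_lt1 SS _ => //.
  by rewrite -QU; move: VE; rewrite /pm (negbTE plusF) => <-.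
split; first by move=> a; rewrite LE.
split; last first.
  split; last by split.
  (* One factor of the squared norm comes from [W^T], the other from [|D| <= |W (a - b)|]. *)
  move=> a b; have := DW a b; rewrite LB.
  move: (S *m _) (a - b) => D d DWd.
  rewrite (le_trans (enormD _ _)) // enormN mulrDl mul1r lerD2l.
  have WT := opbound_tr (opnorm_ge0 W) (opnorm_bound W).
  rewrite (le_trans (WT D)) // expr2 -mulrA ler_wpM2l ?opnorm_ge0 //.
  exact: le_trans DWd (opnorm_bound W d).
pose p := proxV V h x; pose a := - (U^T *m (x - p)).
have pE : T (shift a) = p.
  apply: proxV_subgrad => //; first by case: hGamma0.
  (* Both sides agree because [U U^T (x - p) = - U a]. *)
  suff -> : P *m (shift a - p) = V *m (x - p) by exact: subgrad_proxV.
  rewrite /a /shift VE QU /mp /pm mulmxBr.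
  have PiU (v : 'cV[R]_r) : P *m (invmx P *m U *m v) = U *m v.
    by rewrite -mulmxA mulKVmx.
  case: ifP => _.
    by rewrite mulmxBr PiU mulmxN opprK mulmxDl -(mulmxA U) (mulmxBr P) addrAC.
  by rewrite mulmxDr PiU mulmxN mulmxBl -(mulmxA U) (mulmxBr P) addrAC.
exists a; split; [|by rewrite TE pE|exact: TE].
have La : L a = 0 by rewrite LE pE /a addrN.
split=> // b Lb; apply/eqP; rewrite -subr_eq0 -enorm_eq0 -sqrf_eq0.
have := Lmono a b; rewrite La Lb subrr.
have -> : dotv 0 (a - b) = 0 by rewrite dotvC -[0](scale0r (a - b)) dotvZr mul0r.
by rewrite pmulr_rle0 // => ab; rewrite eq_le ab sqr_ge0.
Qed.
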